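(* Let $r,s$ be positive integers with $r>s$, and let $n_1,\ldots,n_r$ be integers with $2\leq n_1\leq n_2\leq\cdots\leq n_r$. Then $$\mathrm{R}_{r,s}(P_{n_1},\ldots,P_{n_r})\geq \left\lfloor\frac{n_1-1}{2}\right\rfloor\left\lfloor\frac{r}{s}\right\rfloor+1.$$
   Context: $P_n$ denotes the path on $n$ vertices. For positive integers $r\ge s$ and graphs $G_1,\dots,G_r$, the set-coloring Ramsey number $\mathrm{R}_{r,s}(G_1,\dots,G_r)$ is the least $N\in\mathbb{N}$ such that for every coloring $\chi:E(K_N)\to\binom{[r]}{s}$ (each edge receives a set of $s$ distinct colors from $[r]$) there exist $i\in[r]$ and a copy of $G_i$ in $K_N$ with $i\in\chi(e)$ for every edge $e$ of this copy. *)

(* Defs.v *)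
From HB Require Import structures.
From mathcomp Require Import all_boot.

Set Implicit Arguments.
Unset Strict Implicit.
Unset Printing Implicit Defensive.

Record sgraph := SGraph {
  svertex :> finType;
  sedge : rel svertex;
  sedge_sym : symmetric sedge;
  sedge_irr : irreflexive sedge }.

Definition edge_set (G : sgraph) : {set {set G}} :=
  [set e : {set G} | [exists x, exists y, sedge x y && (e == [set x; y])]].

Definition edge (G : sgraph) := {e : {set G} | e \in edge_set G}.

Lemma complete_sym N : symmetric (fun x y : 'I_N => x != y).
Proof. by move=> x y; rewrite eq_sym. Qed.

Lemma complete_irr N : irreflexive (fun x y : 'I_N => x != y).
Proof. by move=> x; rewrite eqxx. Qed.

Definition complete_graph (N : nat) : sgraph :=
  SGraph (@complete_sym N) (@complete_irr N).

Lemma path_sym n : symmetric (fun x y : 'I_n => (x.+1 == y) || (y.+1 == x)).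
Proof. by move=> x y; rewrite orbC. Qed.

Lemma path_irr n : irreflexive (fun x y : 'I_n => (x.+1 == y) || (y.+1 == x)).
Proof. by move=> x; rewrite orbb gtn_eqF. Qed.

Definition path_graph (n : nat) : sgraph :=
  SGraph (@path_sym n) (@path_irr n).

Definition set_coloring (r s N : nat) :=
  {ffun edge (complete_graph N) -> {C : {set 'I_r} | #|C| == s}}.

(* A copy of G in K_N is given by an injection f of the vertices; its edges
   are the images f @: e of the edges e of G. *)
Definition copy_in_color (r s N : nat) (chi : set_coloring r s N) (G : sgraph)
    (i : 'I_r) (f : {ffun G -> complete_graph N}) : bool :=
  injectiveb f &&
  [forall e : edge (complete_graph N),
     (val e \in [set f @: e' | e' : {set G} in edge_set G])
       ==> (i \in val (chi e))].

Definition arrows (r s : nat) (G : 'I_r -> sgraph) (N : nat) : bool :=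
  [forall chi : set_coloring r s N, exists i : 'I_r,
     exists f : {ffun G i -> complete_graph N}, copy_in_color chi i f].

Lemma ramsey_cliques (r : nat) (k : 'I_r -> nat) :
  exists N, forall (T : finType) (c : T -> T -> 'I_r) (S : {set T}),
    (forall x y, c x y = c y x) -> N <= #|S| ->
    exists i, exists2 K : {set T}, K \subset S /\ #|K| = k i &
      {in K &, forall x y, x != y -> c x y = i}.
Proof.
have [m] := ubnP (\sum_i k i); elim: m k => // m IHm k ltkm.
have [/existsP[i /eqP ki0]|] := boolP [exists i, k i == 0].
  exists 0 => T c S _ _; exists i; exists set0; last by move=> x y; rewrite inE.
  by rewrite sub0set cards0 ki0.
rewrite negb_exists => /forallP k_neq0.
pose k' i j := if j == i then (k j).-1 else k j.
have /fin_all_exists[M MP] : forall i, exists N,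
    forall (T : finType) (c : T -> T -> 'I_r) (S : {set T}),
    (forall x y, c x y = c y x) -> N <= #|S| ->
    exists j, exists2 K : {set T}, K \subset S /\ #|K| = k' i j &
      {in K &, forall x y, x != y -> c x y = j}.
  move=> i; apply: IHm; rewrite -ltnS; apply: leq_trans ltkm.
  rewrite ltnS (bigD1 i) //= [ltnRHS](bigD1 i) //= /k' eqxx.
  rewrite (eq_bigr k) => [|j /negPf-> //].
  by rewrite ltn_add2r prednK ?lt0n.
exists (\sum_i M i).+2 => T c S c_sym leS.
have /card_gt0P[x xS] : 0 < #|S| by apply: leq_trans leS.
pose Sx i := [set y in S :\ x | c x y == i].
have /existsP[i leM] : [exists i, M i <= #|Sx i|].
  apply: contraLR leS; rewrite negb_exists -ltnNge => /forallP ltM.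
  rewrite (cardsD1 x) xS !ltnS -sum1_card.
  rewrite (partition_big (c x) predT) //=; apply: leq_sum => i _.
  have := ltM i; rewrite -ltnNge => /ltnW; apply: leq_trans.
  rewrite sum1_card; apply/eq_leq/eq_card => y.
  by rewrite [in RHS]inE.
have [j [K [KS cardK] cK]] := MP i T c (Sx i) c_sym leM.
have KP y : y \in K -> [/\ y != x, y \in S & c x y = i].
  by move=> /(subsetP KS); rewrite !inE => /andP[/andP[-> ->] /eqP].
exists j; move: cardK; rewrite /k'; case: eqP => [ji|_] cardK; last first.
  by exists K => //; split=> //; apply/subsetP => y /KP[].
exists (x |: K) => [|y z].
  split; first by apply/subsetP => y; rewrite !inE => /predU1P[->|/KP[]].
  rewrite cardsU1 cardK; have -> : x \notin K.
    by apply/negP => /KP[]; rewrite eqxx.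
  by rewrite add1n prednK // lt0n.
rewrite !inE => /predU1P[->|yK] /predU1P[->|zK]; rewrite ?eqxx // => nyz.
- by have [_ _ ->] := KP _ zK.
- by rewrite c_sym; have [_ _ ->] := KP _ yK.
- exact: cK.
Qed.

Lemma arrows_exists (r s : nat) (G : 'I_r -> sgraph) :
  0 < s -> s <= r -> exists N, arrows s G N.
Proof.
move=> s_gt0 s_le_r; have r_gt0 := leq_trans s_gt0 s_le_r.
have [N NP] := ramsey_cliques (fun i => #|G i|).
exists N; apply/forallP => chi.
pose col (x y : 'I_N) (i : 'I_r) :=
  [exists e : edge (complete_graph N),
     (val e == [set x; y]) && (i \in val (chi e))].
pose c x y := odflt (Ordinal r_gt0) [pick i | col x y i].
have c_sym x y : c x y = c y x.
  by congr (odflt _ _); apply: eq_pick => i; rewrite /col setUC.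
have [|i [K [_ cardK] cK]] := NP _ c [set: 'I_N] c_sym.
  by rewrite cardsT card_ord.
apply/existsP; exists i; apply/existsP.
pose f := [ffun u : G i => enum_val (cast_ord (esym cardK) (enum_rank u))
            : complete_graph N].
have f_inj : injective f.
  by move=> u v; rewrite !ffunE => /enum_val_inj/cast_ord_inj/enum_rank_inj.
have fK u : f u \in K by rewrite ffunE enum_valP.
exists f; apply/andP; split; first exact/injectiveP.
apply/forallP => e; apply/implyP => /imsetP[e' e'G fe].
move: e'G fe; rewrite inE => /existsP[u /existsP[v /andP[uv /eqP->]]].
rewrite imsetU !imset_set1 => val_e.
have nuv : f u != f v.
  by apply: contraTneq uv => /f_inj->; rewrite sedge_irr.
have := cK _ _ (fK u) (fK v) nuv; rewrite /c; case: pickP => [j|no_col _].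
  move=> /existsP[e1 /andP[/eqP val_e1 je1]] /= <-.
  by rewrite (_ : e = e1) //; apply: val_inj; rewrite val_e val_e1.
have /card_gt0P[j je] : 0 < #|val (chi e)| by rewrite (eqP (valP (chi e))).
by have /existsP[] := no_col j; exists e; rewrite val_e eqxx.
Qed.

Definition set_ramsey (r s : nat) (s_gt0 : 0 < s) (s_le_r : s <= r)
    (G : 'I_r -> sgraph) : nat :=
  ex_minn (arrows_exists G s_gt0 s_le_r).

(* Main.v *)
Require Import Defs.
From mathcomp Require Import all_boot.
From mathcomp Require Import zify.

Set Implicit Arguments.
Unset Strict Implicit.
Unset Printing Implicit Defensive.

(** Put [k = r %/ s] and [m = (n_1 - 1) %/ 2]. The first [k * s] colors are cut
    into [k] groups of size [s], and the edge [{x, y}] of a complete graph on at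
    most [m * k] vertices receives the group of index [x + y] modulo [k]. Along
    a path in one color, [x + y] is constant modulo [k] on consecutive vertices,
    so every other vertex lies in the same residue class modulo [k]. A path on
    [n_1 >= 2 * m + 1] vertices would thus put [m + 1] distinct vertices in a
    residue class which has at most [m] elements. *)

Definition color_group (r s c : nat) : {set 'I_r} := [set i : 'I_r | i %/ s == c].

(** The bound on [c] makes [c.+1 * s <= r], so the group is a full block of [s] colors rather than
    the incomplete block left at the end. *)
Lemma card_color_group (r s c : nat) :
  0 < s -> c < r %/ s -> #|color_group r s c| = s.
Proof.
move=> s_gt0 ltc.
have le_r : c.+1 * s <= r by rewrite -leq_divRL.
have lt_r (j : 'I_s) : c * s + j < r.
  by apply: leq_trans le_r; rewrite mulSn addnC ltn_add2r.
pose h j := Ordinal (lt_r j).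
have h_inj : injective h.
  by move=> j j' /(congr1 val) /= /addnI /val_inj.
have -> : color_group r s c = h @: [set: 'I_s].
  apply/setP => i; rewrite inE; apply/eqP/imsetP => [ic | [j _ ->]].
    exists (Ordinal (ltn_pmod i s_gt0)); rewrite ?inE //.
    by apply: val_inj; rewrite /= -ic -divn_eq.
  by rewrite /= divnMDl // divn_small ?addn0.
by rewrite card_imset // cardsT card_ord.
Qed.

Lemma exists_sum_coloring (r s N : nat) : 0 < s -> s <= r ->
  exists chi : set_coloring r s N, forall e : edge (complete_graph N),
    val (chi e) = color_group r s ((\sum_(x in val e) (x : 'I_N)) %% (r %/ s)).
Proof.
move=> s_gt0 le_sr.
have cardP (e : edge (complete_graph N)) :
    #|color_group r s ((\sum_(x in val e) (x : 'I_N)) %% (r %/ s))| == s.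
  by rewrite card_color_group // ltn_mod divn_gt0.
(* Summing over the edge as a set spares any choice of order on its endpoints. *)
exists [ffun e => exist (fun C : {set 'I_r} => #|C| == s) _ (cardP e)] => e.
by rewrite ffunE.
Qed.

Lemma copy_edge_color (r s N : nat) (chi : set_coloring r s N) (G : sgraph)
    (i : 'I_r) (f : {ffun G -> complete_graph N}) (u v : G) :
  copy_in_color chi i f -> sedge u v ->
  exists2 e : edge (complete_graph N),
    val e = [set f u; f v] & i \in val (chi e).
Proof.
move=> /andP[/injectiveP f_inj /forallP copy] uv.
have nuv : f u != f v.
  by apply: contraTneq uv => /f_inj->; rewrite sedge_irr.
have eK : [set f u; f v] \in edge_set (complete_graph N).
  by rewrite inE; apply/existsP; exists (f u); apply/existsP; exists (f v);
    apply/andP.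
exists (exist (fun e => e \in edge_set (complete_graph N)) _ eK) => //.
apply: (implyP (copy _)); apply/imsetP; exists [set u; v].
  by rewrite inE; apply/existsP; exists u; apply/existsP; exists v; apply/andP.
by rewrite imsetU !imset_set1.
Qed.

(** Division by [k] is injective on a residue class; if [N <= m * k], its quotients lie below [m],
    against the pigeonhole principle. *)
Lemma residue_class_bound (m k N c : nat) (g : 'I_m.+1 -> 'I_N) :
  0 < k -> injective g -> (forall j, g j = c %[mod k]) -> m * k < N.
Proof.
move=> k_gt0 g_inj gc; rewrite ltnNge; apply/negP => leN.
have lt_m j : g j %/ k < m by rewrite ltn_divLR // (leq_trans (ltn_ord _)).
pose q j := Ordinal (lt_m j).
have q_inj : injective q.
  move=> j j' /(congr1 val) /= qE; apply/g_inj/val_inj => /=.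
  by rewrite (divn_eq (g j) k) (divn_eq (g j') k) qE !gc.
by have := leq_card q q_inj; rewrite !card_ord ltnn.
Qed.

Lemma sum_coloring_path_bound (r s N m n : nat) (chi : set_coloring r s N)
    (i : 'I_r) (f : {ffun path_graph n -> complete_graph N}) :
  0 < s -> s <= r ->
  (forall e : edge (complete_graph N),
    val (chi e) = color_group r s ((\sum_(x in val e) (x : 'I_N)) %% (r %/ s))) ->
  copy_in_color chi i f -> m.*2 < n -> m * (r %/ s) < N.
Proof.
move=> s_gt0 le_sr chiE copy lt_n; set k := r %/ s.
have f_inj : injective f by case/andP: copy => /injectiveP.
(* Color [i] lies only in the group of index [i %/ s], which fixes the sum along each edge of the
   copy. *)
have f_sum (u v : 'I_n) : u.+1 = v -> (f u : 'I_N) + (f v : 'I_N) = i %/ s %[mod k].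
  move=> uv; have sE : @sedge (path_graph n) u v by rewrite /= uv eqxx.
  have nuv : f u != f v.
    by apply: contraTneq sE => /f_inj->; rewrite sedge_irr.
  have [e eE] := copy_edge_color copy sE; rewrite chiE inE eE => /eqP ->.
  by rewrite modn_mod big_setU1 ?inE //= big_set1.
have lt_pos (j : 'I_m.+1) : j.*2 < n by have := ltn_ord j; lia.
have lt0 : 0 < n by lia.
pose pos j : 'I_n := Ordinal (lt_pos j).
(* The even positions [0, 2, ..., 2m] supply the [m.+1] vertices, in the class of the first one. *)
apply: (@residue_class_bound m k N (f (Ordinal lt0) : 'I_N) (fun j => f (pos j))).
- by rewrite divn_gt0.
- by move=> j j' /f_inj /(congr1 val) /= /double_inj /val_inj.
move=> [j ltj]; rewrite /pos /=; elim: j ltj {pos} => [|j IHj] ltj.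
  by congr ((f _ : 'I_N) %% k); apply: val_inj.
rewrite -(IHj (ltnW ltj)).
have lt1 : j.*2.+1 < n by lia.
pose u := Ordinal (lt_pos (Ordinal ltj)).
pose v := Ordinal (lt_pos (Ordinal (ltnW ltj))).
have : (f u : 'I_N) = (f v : 'I_N) %[mod k]; last by [].
(* Adding the image of the middle vertex [2j+1] turns both sides into edge sums. *)
apply/eqP; rewrite -(eqn_modDl (f (Ordinal lt1) : 'I_N)) f_sum // addnC.
by rewrite f_sum.
Qed.

Theorem theorem2p7 (r s : nat) (r_gt0 : 0 < r) (s_gt0 : 0 < s) (s_lt_r : s < r)
    (n : 'I_r -> nat) (n_ge2 : 2 <= n (Ordinal r_gt0))
    (n_mono : forall i j : 'I_r, i <= j -> n i <= n j) :
  set_ramsey s_gt0 (ltnW s_lt_r) (fun i => path_graph (n i))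
    >= (n (Ordinal r_gt0) - 1) %/ 2 * (r %/ s) + 1.
Proof.
rewrite /set_ramsey; case: ex_minnP => N /forallP arrN _; rewrite addn1.
have [chi chiE] := exists_sum_coloring N s_gt0 (ltnW s_lt_r).
have /existsP[i /existsP[f copy]] := arrN chi.
apply: sum_coloring_path_bound chiE copy _ => //; first exact: ltnW.
(* Whichever color [i] occurs, its path has at least [n_1 > 2m] vertices. *)
have : n (Ordinal r_gt0) <= n i by exact: n_mono.
by have := leq_divM (n (Ordinal r_gt0) - 1) 2; lia.
Qed.
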